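(* The collection $\mathcal{F}$ and set functions $\nu^+$, $\nu^-$ and $\nu$ have the following properties. 1. $\emptyset, \mathbb{N} \in \mathcal{F}$, with $\nu(\emptyset) = 0$ and $\nu(\mathbb{N}) = 1$. 2. For all $A \in \mathcal{F}$, $A^c \in \mathcal{F}$ with $\nu(A^c) = 1 - \nu(A)$. 3. For all $A, B \in \mathcal{F}$, $A \cup B \in \mathcal{F}$ if and only if $A \cap B \in \mathcal{F}$, and if either is true then $\nu(A \cup B) = \nu(A) + \nu(B) - \nu(A \cap B)$. 4. If $A, B \in \mathcal{P}(\mathbb{N})$, then $\nu^+(A \cup B) \leq \nu^+(A) + \nu^+(B)$. If $A$, $B$, and $A \cup B$ are all in $\mathcal{F}$, then $\nu(A \cup B) \leq \nu(A) + \nu(B)$. 5. For $A, B \in \mathcal{P}(\mathbb{N})$ such that $A \subseteq B$: (a) $\nu^+(A) \leq \nu^+(B)$, (b) $\nu^+(B \setminus A) \geq \nu^+(B) - \nu^+(A)$, (c) $\nu^-(A) \leq \nu^-(B)$, and (d) $\nu^-(B \setminus A) \leq \nu^-(B) - \nu^-(A)$. If in addition $A, B \in \mathcal{F}$, then (a) $\nu(A) \leq \nu(B)$, (b) $B \setminus A \in \mathcal{F}$, (c) $\nu(B \setminus A) = \nu(B) - \nu(A)$, and (d) $\nu(A) = \nu(B) \iff B \setminus A \in \mathcal{N}$. 6. If $A \in \mathcal{N}$, then any $B \subseteq A$ satisfies $B \in \mathcal{N}$. Consequently, for any $A\in\mathcal{N}$ and $C \in \mathcal{P}(\mathbb{N})$,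 (a) $A \cap C, A \setminus C \in \mathcal{N}$, and (b) $\nu^+(A \cup C) = \nu^+(C \setminus A) = \nu^+(C)$. If $C \in \mathcal{F}$, then $A \cup C, C \setminus A \in \mathcal{F}$. 7. For pairwise disjoint sets $A_1, \ldots, A_K \in \mathcal{F}$, $A_1 \cup \ldots \cup A_K \in \mathcal{F}$ with $\nu(A_1 \cup \ldots \cup A_K) = \sum_{k=1}^K \nu(A_k)$. 8. Consider $\mathcal{C} \subseteq \mathcal{P}(\mathbb{N})$. Then $\nu^-(\bigcup \mathcal{C}) \geq \sup\{ \nu^-(A) : A \in \mathcal{C} \}$. In particular, if $\{ A_k \}_{k=1}^{\infty} \subseteq \mathcal{F}$ are pairwise disjoint, then $\nu^-(\bigcup_{k=1}^{\infty} A_k) \geq \sum_{k=1}^{\infty} \nu(A_k)$. 9. Consider a chain $\mathcal{C} \subseteq \mathcal{P}(\mathbb{N})$ such that $\nu_N(A) \leq \nu^+(A)$ for all $N \in \mathbb{N}$ and $A \in \mathcal{C}$. Then (a) $\nu^+(\bigcup \mathcal{C}) = \sup_{A \in \mathcal{C}} \nu^+(A)$, and (b) if $\mathcal{C} \subseteq \mathcal{F}$, then $\bigcup \mathcal{C} \in \mathcal{F}$ with $\nu(\bigcup \mathcal{C}) = \sup_{A \in \mathcal{C}} \nu(A)$. In particular, if $\{ A_k \}_{k=1}^{\infty} \subseteq \mathcal{F}$ are pairwise disjoint with $\nu_N(A_k) \leq \nu(A_k)$ for all $k, N \in \mathbb{N}$, then $\bigcup_{k=1}^{\infty} A_k \in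 \mathcal{F}$ and $\nu(\bigcup_{k=1}^{\infty} A_k) = \sum_{k=1}^{\infty} \nu(A_k)$. 10. Consider $\mathcal{C} \subseteq \mathcal{F}$. If $\sup \{ \nu(A) : A \in \mathcal{C} \} = 1$, then $\bigcup \mathcal{C} \in \mathcal{F}$ and $\nu(\bigcup \mathcal{C}) = 1$. In particular, if $\{ A_k \}_{k=1}^{\infty} \subseteq \mathcal{F}$ are pairwise disjoint with $\sum_{k=1}^{\infty} \nu(A_k) = 1$, then $\bigcup_{k=1}^{\infty} A_k \in \mathcal{F}$ and $\nu(\bigcup_{k=1}^{\infty} A_k) = 1$.
   Context: $\mathbb{N} = \{1,2,3,\ldots\}$, $\mathcal{P}(\mathbb{N})$ is its power set, and complements are taken in $\mathbb{N}$. For $A \subseteq \mathbb{N}$ and $N \in \mathbb{N}$, $\nu_N(A) := \frac{1}{N}\sum_{n=1}^N I_A(n)$, where $I_A$ is the indicator function of $A$; $\nu^+(A) := \limsup_{N\to\infty}\nu_N(A)$ and $\nu^-(A) := \liminf_{N\to\infty}\nu_N(A)$. $\mathcal{F}$ is the collection of all $A \subseteq \mathbb{N}$ for which $\lim_{N\to\infty}\nu_N(A)$ exists, and for $A\in\mathcal{F}$, $\nu(A)$ denotes this limit. $\mathcal{N} := \{A\in\mathcal{F} : \nu(A)=0\}$. A chain is a collection of sets totally ordered by inclusion. Suprema are taken in $[0,1]$, so $\sup\emptyset=0$, and $\bigcup\emptyset=\emptyset$. *)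

(* Defs.v *)
From HB Require Import structures.
From mathcomp Require Import all_boot all_order all_algebra.
From mathcomp Require Import all_classical all_reals all_analysis.
Set Implicit Arguments.
Unset Strict Implicit.
Unset Printing Implicit Defensive.
Import Order.TTheory GRing.Theory Num.Theory.
Import numFieldNormedType.Exports.
Local Open Scope classical_set_scope.
Local Open Scope ring_scope.

(* The positive integers 1, 2, 3, ...; as a type of its own, so that [~` A] and
   [setT] on [set posnat] are the complement in, and the whole of, this set. *)
Definition posnat : Type := {n : nat | (0 < n)%N}.

Definition succpos (n : nat) : posnat := exist _ n.+1 (ltn0Sn n).

(* The proportion of {1, ..., N} lying in A: the summation index n < N stands
   for the positive integer n + 1.  The value at N = 0 is a dummy, irrelevant
   to the limits below. *)
Definition dens_at (R : realType) (N : nat) (A : set posnat) : R :=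
  N%:R^-1 * \sum_(n < N) \1_A (succpos n).

(* The sequence [dens_at R ^~ A] takes values in [0, 1], so the real-valued
   limits superior and inferior are the usual ones. *)
Definition upper_dens (R : realType) (A : set posnat) : R :=
  limn_sup (fun N => dens_at R N A).

Definition lower_dens (R : realType) (A : set posnat) : R :=
  limn_inf (fun N => dens_at R N A).

Definition has_dens (R : realType) : set (set posnat) :=
  [set A | cvgn (fun N => dens_at R N A)].

(* Meaningful only on [has_dens R]. *)
Definition dens (R : realType) (A : set posnat) : R :=
  limn (fun N => dens_at R N A).

Definition null_dens (R : realType) : set (set posnat) :=
  [set A | has_dens R A /\ dens R A = 0].

Definition is_chain (C : set (set posnat)) : Prop :=
  total_on C (fun A B => A `<=` B).

(* Main.v *)
Require Import Defs.
From HB Require Import structures.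
From mathcomp Require Import all_boot all_order all_algebra.
From mathcomp Require Import all_classical all_reals all_analysis.
Set Implicit Arguments.
Unset Strict Implicit.
Unset Printing Implicit Defensive.
Import Order.TTheory GRing.Theory Num.Theory.
Import numFieldNormedType.Exports.
Local Open Scope classical_set_scope.
Local Open Scope ring_scope.

(** Everything rests on exact facts about the proportions of A in {1, ..., N} at a
    fixed N, which are then passed to the limit.

    The proportion is monotone and finitely additive in A ([dens_atUI],
    [dens_atD], [dens_at_bigcup]).  Where the proportions of the sets involved
    converge, finite additivity passes to the density; where they do not, it
    leaves the subadditivity of the limit superior and the superadditivity of the
    limit inferior, and monotonicity survives for both.

    When no convergence is known beforehand, the density of a set is shown to
    exist and to equal l by the sandwich l <= lower density <= upper density <= l
    ([has_dens_sandwich]).  The lower bound is the easy half: by monotonicity the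
    lower density of a union is at least that of each member, hence at least the
    supremum of these, or the sum of the series of densities if the members are
    disjoint ([lower_dens_bigcup_ge], [dens_series_le_lower]).  The upper bound,
    which is where countable additivity fails in general, is available in three
    cases: inside a null set, when l = 1, and for a chain whose members A have all
    their proportions bounded by the upper density of A.  In the last case, the
    finite set {1, ..., N} meets the union of the chain in the same points as some
    single member ([chain_captures_initial_segment]), so that each proportion of
    the union is at most the supremum of the upper densities
    ([upper_dens_chain]).  A disjoint sequence reduces to the chain of its partial
    unions ([has_dens_dominated_bigcup]). *)

(** * Limits superior and inferior of bounded real sequences *)

Lemma cvg_sups_limn_sup (R : realType) (u : R^nat) :
  bounded_fun u -> sups u @ \oo --> limn_sup u.
Proof.
move=> bu; rewrite limn_supE//; apply: cvg_sups_inf.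
- exact: bounded_fun_has_ubound.
- exact: bounded_fun_has_lbound.
Qed.

Lemma cvg_infs_limn_inf (R : realType) (u : R^nat) :
  bounded_fun u -> infs u @ \oo --> limn_inf u.
Proof.
move=> bu; rewrite limn_infE//; apply: cvg_infs_sup.
- exact: bounded_fun_has_ubound.
- exact: bounded_fun_has_lbound.
Qed.

Lemma infs_le_seq_le_sups (R : realType) (u : R^nat) n :
  bounded_fun u -> infs u n <= u n <= sups u n.
Proof.
move=> bu; apply/andP; split.
- apply: ge_inf; last by exists n => /=.
  exact/has_lbound_sdrop/bounded_fun_has_lbound.
- apply: ub_le_sup; last by exists n => /=.
  exact/has_ubound_sdrop/bounded_fun_has_ubound.
Qed.

Lemma limn_sup_le (R : realType) (u v : R^nat) :
  bounded_fun u -> bounded_fun v -> (forall n, u n <= v n) ->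
  limn_sup u <= limn_sup v.
Proof.
move=> bu bv uv; rewrite /limn_sup; apply: ler_lim.
- by apply/cvg_ex; exists (limn_sup u); exact: cvg_sups_limn_sup.
- by apply/cvg_ex; exists (limn_sup v); exact: cvg_sups_limn_sup.
- apply: nearW => n; apply: ge_sup; first by exists (u n); exists n => /=.
  move=> _ [m /= nm <-]; apply: le_trans (uv m) _.
  apply: ub_le_sup; last by exists m.
  exact/has_ubound_sdrop/bounded_fun_has_ubound.
Qed.

Lemma limn_infNE (R : realType) (u : R^nat) : bounded_fun u ->
  limn_inf u = - limn_sup (-%R \o u).
Proof.
move=> bu.
have niu : - infs u @ \oo --> - limn_inf u.
  exact: cvgN (cvg_infs_limn_inf bu).
by rewrite /limn_sup supsN (cvg_lim _ niu)// opprK.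
Qed.

Lemma limn_inf_le (R : realType) (u v : R^nat) :
  bounded_fun u -> bounded_fun v -> (forall n, u n <= v n) ->
  limn_inf u <= limn_inf v.
Proof.
move=> bu bv uv; rewrite !limn_infNE// lerN2; apply: limn_sup_le.
- exact: bounded_funN.
- exact: bounded_funN.
- by move=> n /=; rewrite lerN2.
Qed.

Lemma bounded_limn_inf_sup (R : realType) (u : R^nat) :
  bounded_fun u -> limn_inf u <= limn_sup u.
Proof.
move=> bu; rewrite /limn_inf /limn_sup; apply: ler_lim.
- by apply/cvg_ex; exists (limn_inf u); exact: cvg_infs_limn_inf.
- by apply/cvg_ex; exists (limn_sup u); exact: cvg_sups_limn_sup.
- apply: nearW => n.
  by have /andP[] := infs_le_seq_le_sups n bu; exact: le_trans.
Qed.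

(** The inequality of the limits inferior and superior collapses both of them to
    [l]; the sequence is then squeezed between its tail infima and suprema. *)
Lemma limn_inf_sup_cvg (R : realType) (u : R^nat) (l : R) :
  bounded_fun u -> l <= limn_inf u -> limn_sup u <= l -> u @ \oo --> l.
Proof.
move=> bu li ls; have lis := bounded_limn_inf_sup bu.
have infl : limn_inf u = l.
  by apply/eqP; rewrite eq_le li (le_trans lis ls).
have supl : limn_sup u = l.
  by apply/eqP; rewrite eq_le ls (le_trans li lis).
apply: (@squeeze_cvgr _ _ _ _ (infs u) (sups u)).
- by apply: nearW => n; exact: infs_le_seq_le_sups.
- by rewrite -infl; exact: cvg_infs_limn_inf.
- by rewrite -supl; exact: cvg_sups_limn_sup.
Qed.

(** * The proportion of a set among the first N positive integers *)

(** Monotonicity needs the inclusion on {1, ..., N} alone.  This is what lets a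
    whole union be replaced by one member of a chain, in [upper_dens_chain]. *)
Lemma dens_at_restrict_le (R : realType) N (A B : set posnat) :
  (forall n, (n < N)%N -> A (succpos n) -> B (succpos n)) ->
  dens_at R N A <= dens_at R N B.
Proof.
move=> AB; rewrite /dens_at ler_wpM2l ?invr_ge0//; apply: ler_sum => n _.
rewrite !indicE ler_nat; case: (boolP (_ \in A)) => //.
by rewrite inE => /(AB _ (ltn_ord n)) Bn; rewrite mem_set.
Qed.

Lemma dens_at_le (R : realType) N (A B : set posnat) :
  A `<=` B -> dens_at R N A <= dens_at R N B.
Proof. by move=> AB; apply: dens_at_restrict_le => n _; exact: AB. Qed.

Lemma dens_at0 (R : realType) N : dens_at R N set0 = 0.
Proof.
by rewrite /dens_at big1 ?mulr0// => n _; rewrite indic0.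
Qed.

Lemma dens_atT (R : realType) N : dens_at R N.+1 setT = 1.
Proof.
rewrite /dens_at (eq_bigr (fun=> 1)) => [|n _]; last by rewrite indicT.
by rewrite sumr_const card_ord mulVf// pnatr_eq0.
Qed.

Lemma dens_at_ge0 (R : realType) N (A : set posnat) : 0 <= dens_at R N A.
Proof. by rewrite -(dens_at0 R N); exact: dens_at_le. Qed.

Lemma dens_at_le1 (R : realType) N (A : set posnat) : dens_at R N A <= 1.
Proof.
case: N => [|N]; first by rewrite /dens_at big_ord0 mulr0.
by rewrite -(dens_atT R N); exact: dens_at_le.
Qed.

Lemma bounded_dens_at (R : realType) (A : set posnat) :
  bounded_fun (fun N => dens_at R N A).
Proof.
exists 1; split => [|x x1 N _]; first exact: num_real.
by rewrite /= ger0_norm ?dens_at_ge0// (le_trans (dens_at_le1 _ _ _))// ltW.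
Qed.

(** All the additivity of density comes from this identity, which holds before any
    limit is taken. *)
Lemma dens_atUI (R : realType) N (A B : set posnat) :
  dens_at R N (A `|` B) + dens_at R N (A `&` B) =
  dens_at R N A + dens_at R N B.
Proof.
rewrite /dens_at -!mulrDr -!big_split; congr (_ * _); apply: eq_bigr => n _ /=.
rewrite !indicE in_setU in_setI.
by case: (_ \in A); case: (_ \in B); rewrite /= ?addr0 ?add0r.
Qed.

Lemma dens_atD (R : realType) N (A B : set posnat) : A `<=` B ->
  dens_at R N (B `\` A) = dens_at R N B - dens_at R N A.
Proof.
move=> AB; have := dens_atUI R N A (B `\` A).
rewrite setDE setICA setICr setI0 dens_at0 addr0 -setDE setDUK// => ->.
by rewrite addrC addKr.
Qed.

Lemma dens_at_bigcup (R : realType) N (I : finType) (A : I -> set posnat) :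
  trivIset setT A ->
  dens_at R N (\bigcup_(i in [set: I]) A i) = \sum_i dens_at R N (A i).
Proof.
move=> tA; rewrite /dens_at -mulr_sumr exchange_big; congr (_ * _).
apply: eq_bigr => n _ /=; rewrite indicE.
case: (boolP (_ \in _)) => [|/negP nU]; last first.
  rewrite big1// => i _; rewrite indicE; case: (boolP (_ \in _)) => // nAi.
  by exfalso; apply: nU; rewrite inE; exists i => //; exact: set_mem nAi.
(* A point of the union lies in exactly one of the sets. *)
rewrite inE => -[i _ Ai]; rewrite (bigD1 i)//= indicE mem_set//.
rewrite big1 ?addr0// => j ji; rewrite indicE memNset// => Aj.
by move/eqP : ji; apply; apply: (tA j i) => //; exists (succpos n).
Qed.

(** * Monotonicity of the densities and criteria for existence *)

Lemma upper_dens_le_ub (R : realType) (A : set posnat) (c : R) :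
  (forall N, (0 < N)%N -> dens_at R N A <= c) -> upper_dens R A <= c.
Proof.
move=> Ac; have cc : (fun=> c) @ \oo --> c by exact: cvg_cst.
rewrite -[leRHS](cvg_limn_inf_sup cc).2.
apply: limn_sup_le; [exact: bounded_dens_at|exact: bounded_cst|].
(* The dummy value 0 at N = 0 is below c because the proportion at N = 1 is. *)
case=> [|N]; last exact: Ac.
rewrite {1}/dens_at big_ord0 mulr0.
by rewrite (le_trans (dens_at_ge0 R 1 A))// Ac.
Qed.

Lemma upper_dens_le (R : realType) (A B : set posnat) :
  A `<=` B -> upper_dens R A <= upper_dens R B.
Proof.
by move=> AB; apply: limn_sup_le => [||N];
  [exact: bounded_dens_at|exact: bounded_dens_at|exact: dens_at_le].
Qed.

Lemma lower_dens_le (R : realType) (A B : set posnat) :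
  A `<=` B -> lower_dens R A <= lower_dens R B.
Proof.
by move=> AB; apply: limn_inf_le => [||N];
  [exact: bounded_dens_at|exact: bounded_dens_at|exact: dens_at_le].
Qed.

Lemma upper_dens_le1 (R : realType) (A : set posnat) : upper_dens R A <= 1.
Proof. by apply: upper_dens_le_ub => N _; exact: dens_at_le1. Qed.

Lemma has_densE (R : realType) (A : set posnat) : has_dens R A ->
  upper_dens R A = dens R A /\ lower_dens R A = dens R A.
Proof. by move=> hA; split; [exact: cvg_limn_supE|exact: cvg_limn_infE]. Qed.

Lemma has_dens_cvg (R : realType) (A : set posnat) (l : R) :
  dens_at R ^~ A @ \oo --> l -> has_dens R A /\ dens R A = l.
Proof.
by move=> Al; split; [apply/cvg_ex; exists l|exact: cvg_lim Al].
Qed.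

(** Every existence result below for which no formula for the proportions is at
    hand goes through this criterion. *)
Lemma has_dens_sandwich (R : realType) (A : set posnat) (l : R) :
  l <= lower_dens R A -> upper_dens R A <= l -> has_dens R A /\ dens R A = l.
Proof.
move=> lA Al; apply/has_dens_cvg/limn_inf_sup_cvg => //.
exact: bounded_dens_at.
Qed.

Lemma has_dens0 (R : realType) : has_dens R set0 /\ dens R set0 = 0.
Proof.
apply: has_dens_cvg; under eq_fun do rewrite dens_at0.
exact: cvg_cst.
Qed.

Lemma has_densT (R : realType) : has_dens R setT /\ dens R setT = 1.
Proof.
apply: has_dens_cvg; rewrite -(cvg_shiftS (dens_at R ^~ setT)).
under eq_fun do rewrite dens_atT; exact: cvg_cst.
Qed.

Lemma lower_dens_ge0 (R : realType) (A : set posnat) : 0 <= lower_dens R A.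
Proof.
have [h0 d0] := has_dens0 R.
by rewrite -d0 -(has_densE h0).2 lower_dens_le.
Qed.

Lemma dens_le (R : realType) (A B : set posnat) : A `<=` B ->
  has_dens R A -> has_dens R B -> dens R A <= dens R B.
Proof.
move=> AB hA hB; rewrite -(has_densE hA).1 -(has_densE hB).1.
exact: upper_dens_le.
Qed.

Lemma dens_ge0 (R : realType) (A : set posnat) : has_dens R A -> 0 <= dens R A.
Proof. by move=> hA; rewrite -(has_densE hA).2 lower_dens_ge0. Qed.

(** * Complements, differences and unions of two sets *)

Lemma has_densD (R : realType) (A B : set posnat) : A `<=` B ->
  has_dens R A -> has_dens R B ->
  has_dens R (B `\` A) /\ dens R (B `\` A) = dens R B - dens R A.
Proof.
move=> AB hA hB; apply: has_dens_cvg; under eq_fun do rewrite dens_atD//.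
exact: cvgB hB hA.
Qed.

Lemma has_densC (R : realType) (A : set posnat) : has_dens R A ->
  has_dens R (~` A) /\ dens R (~` A) = 1 - dens R A.
Proof.
by move=> hA; have [hT <-] := has_densT R; rewrite -setTD; exact: has_densD.
Qed.

(** In [dens_atUI] the union and the intersection play symmetric roles; keeping
    them abstract, as [S] and [D], gives both directions of [has_densU]. *)
Lemma has_dens_complementary (R : realType) (A B S D : set posnat) :
  (forall N, dens_at R N S + dens_at R N D = dens_at R N A + dens_at R N B) ->
  has_dens R A -> has_dens R B -> has_dens R D ->
  has_dens R S /\ dens R S = dens R A + dens R B - dens R D.
Proof.
move=> SD hA hB hD; apply: has_dens_cvg.
have -> : dens_at R ^~ S =
    (fun N => dens_at R N A + dens_at R N B - dens_at R N D).
  by apply/funext => N; rewrite -SD addrK.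
exact: cvgB (cvgD hA hB) hD.
Qed.

Lemma has_densU (R : realType) (A B : set posnat) :
  has_dens R A -> has_dens R B ->
  (has_dens R (A `|` B) <-> has_dens R (A `&` B)) /\
  (has_dens R (A `|` B) \/ has_dens R (A `&` B) ->
   dens R (A `|` B) = dens R A + dens R B - dens R (A `&` B)).
Proof.
move=> hA hB.
have I2U : has_dens R (A `&` B) -> has_dens R (A `|` B) /\
    dens R (A `|` B) = dens R A + dens R B - dens R (A `&` B).
  by apply: has_dens_complementary => // N; exact: dens_atUI.
have U2I : has_dens R (A `|` B) -> has_dens R (A `&` B).
  move=> hU; apply: (has_dens_complementary _ hA hB hU).1 => N.
  by rewrite addrC dens_atUI.
split; first by split => [|/I2U[]].
by case=> [/U2I|] /I2U[].
Qed.

Lemma upper_densU_le (R : realType) (A B : set posnat) :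
  upper_dens R (A `|` B) <= upper_dens R A + upper_dens R B.
Proof.
have bA := @bounded_dens_at R A; have bB := @bounded_dens_at R B.
apply: le_trans (le_limn_supD bA bB); apply: limn_sup_le.
- exact: bounded_dens_at.
- exact: bounded_funD.
- by move=> N /=; rewrite -dens_atUI lerDl dens_at_ge0.
Qed.

Lemma lower_densD_le (R : realType) (A B : set posnat) : A `<=` B ->
  lower_dens R (B `\` A) <= lower_dens R B - lower_dens R A.
Proof.
move=> AB; rewrite lerBrDr.
have := le_limn_infD (@bounded_dens_at R (B `\` A)) (@bounded_dens_at R A).
by congr (_ <= limn_inf _); apply/funext => N /=; rewrite dens_atD// subrK.
Qed.

Lemma upper_densD_ge (R : realType) (A B : set posnat) : A `<=` B ->
  upper_dens R B - upper_dens R A <= upper_dens R (B `\` A).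
Proof.
by move=> AB; rewrite lerBlDl -[in leLHS](setDUK AB) upper_densU_le.
Qed.

(** * Null sets *)

Lemma null_dens_sub (R : realType) (A B : set posnat) :
  null_dens R A -> B `<=` A -> null_dens R B.
Proof.
move=> [hA A0] BA; apply: has_dens_sandwich; first exact: lower_dens_ge0.
by rewrite -A0 -(has_densE hA).1 upper_dens_le.
Qed.

(** The three upper densities bound each other in a circle: [C `\` A] lies in
    [C], which lies in [A `|` C], and subadditivity bounds the last one by the
    first since [A] contributes nothing. *)
Lemma upper_dens_null_eq (R : realType) (A C : set posnat) : null_dens R A ->
  upper_dens R (A `|` C) = upper_dens R (C `\` A) /\
  upper_dens R (C `\` A) = upper_dens R C.
Proof.
move=> [hA A0].
have UD : upper_dens R (A `|` C) <= upper_dens R (C `\` A).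
  have -> : A `|` C = A `|` (C `\` A) by rewrite setDE setUIr setUCr setIT.
  by rewrite (le_trans (upper_densU_le _ _ _))// (has_densE hA).1 A0 add0r.
have DC : upper_dens R (C `\` A) <= upper_dens R C by exact: upper_dens_le.
have CU : upper_dens R C <= upper_dens R (A `|` C) by exact: upper_dens_le.
by split; apply/eqP; rewrite eq_le ?UD ?DC ?(le_trans CU UD) ?(le_trans DC CU).
Qed.

Lemma has_dens_null_modification (R : realType) (A C : set posnat) :
  null_dens R A -> has_dens R C ->
  has_dens R (A `|` C) /\ has_dens R (C `\` A).
Proof.
move=> nA hC; have [hI _] := null_dens_sub nA (@subIsetl _ A C).
split; first by apply/(has_densU nA.1 hC).1.
have -> : C `\` A = C `\` (A `&` C) by rewrite setDIr setDv setU0.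
by have [] := has_densD (@subIsetr _ A C) hI hC.
Qed.

(** * Finite and countable disjoint unions *)

Lemma has_dens_bigcup_fin (R : realType) (I : finType) (A : I -> set posnat) :
  (forall i, has_dens R (A i)) -> trivIset setT A ->
  has_dens R (\bigcup_(i in [set: I]) A i) /\
  dens R (\bigcup_(i in [set: I]) A i) = \sum_i dens R (A i).
Proof.
move=> hA tA; apply: has_dens_cvg; under eq_fun do rewrite dens_at_bigcup//.
apply: cvg_big => [|i _]; [exact: add_continuous|exact: hA].
Qed.

Definition partial_union (A : nat -> set posnat) (n : nat) : set posnat :=
  \bigcup_(k in [set: 'I_n]) A k.

Lemma partial_union_sub (A : nat -> set posnat) n :
  partial_union A n `<=` \bigcup_(k in [set: nat]) A k.
Proof. by move=> x [k _ Ax]; exists k. Qed.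

Lemma trivIset_ord (A : nat -> set posnat) n : trivIset setT A ->
  trivIset [set: 'I_n] (fun k => A k).
Proof. by move=> tA i j _ _ Aij; apply/val_inj/tA. Qed.

Lemma has_dens_partial_union (R : realType) (A : nat -> set posnat) n :
  (forall k, has_dens R (A k)) -> trivIset setT A ->
  has_dens R (partial_union A n) /\
  dens R (partial_union A n) = \sum_(0 <= k < n) dens R (A k).
Proof.
move=> hA tA; rewrite big_mkord; apply: has_dens_bigcup_fin => //.
exact: trivIset_ord.
Qed.

(** For the empty family the supremum is 0, by convention, and what is left is
    that lower densities are nonnegative. *)
Lemma lower_dens_bigcup_ge (R : realType) (C : set (set posnat)) :
  sup [set lower_dens R A | A in C] <= lower_dens R (\bigcup_(A in C) A).
Proof.
have [->|/set0P[A CA]] := eqVneq C set0.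
  by rewrite image_set0 sup0 lower_dens_ge0.
apply: ge_sup; first by exists (lower_dens R A); exists A.
by move=> _ [B CB <-]; apply: lower_dens_le; exact: bigcup_sup.
Qed.

(** Finite additivity turns each partial sum into the density of a subset of the
    whole union. *)
Lemma dens_series_le_lower (R : realType) (A : nat -> set posnat) :
  (forall k, has_dens R (A k)) -> trivIset setT A ->
  (\sum_(0 <= k <oo) (dens R (A k))%:E <=
   (lower_dens R (\bigcup_(k in [set: nat]) A k))%:E)%E.
Proof.
move=> hA tA; apply: lime_le.
  by apply: is_cvg_nneseries => k _ _; rewrite lee_fin dens_ge0.
apply: nearW => n; rewrite sumEFin lee_fin.
have [hU <-] := has_dens_partial_union n hA tA.
by rewrite -(has_densE hU).2; exact/lower_dens_le/partial_union_sub.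
Qed.

(** * Chains dominated by their upper densities *)

(** Only the finitely many points of {1, ..., N} are concerned: each one that is
    in the union lies in a member of the chain, and the largest of these members
    contains them all. *)
Lemma chain_captures_initial_segment (C : set (set posnat)) N : C !=set0 ->
  is_chain C -> exists2 A, C A &
    forall n, (n < N)%N -> (\bigcup_(B in C) B) (succpos n) -> A (succpos n).
Proof.
move=> [A0 CA0] chC; elim: N => [|N [A CA capA]]; first by exists A0.
have [[B CB BN]|nN] := pselect ((\bigcup_(B in C) B) (succpos N)); last first.
  exists A => // n; rewrite ltnS leq_eqVlt => /predU1P[-> /nN//|]; exact: capA.
have [AB|BA] := chC _ _ CA CB.
  exists B => // n; rewrite ltnS leq_eqVlt => /predU1P[->//|nN Un].
  exact/AB/capA.
exists A => // n; rewrite ltnS leq_eqVlt => /predU1P[-> _|]; first exact: BA.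
exact: capA.
Qed.

Lemma upper_dens_sup_ub (R : realType) (C : set (set posnat)) :
  has_ubound [set upper_dens R A | A in C].
Proof. by exists 1 => _ [A _ <-]; exact: upper_dens_le1. Qed.

(** For each N the proportion of the union is that of a single member [A], which is
    at most the upper density of [A], hence at most the supremum.  The hypothesis
    that the bound holds for every N is essential here, since [A] varies with N:
    bounds valid only for N large, depending on [A], would say nothing. *)
Lemma upper_dens_chain (R : realType) (C : set (set posnat)) : is_chain C ->
  (forall (N : nat) (A : set posnat), (0 < N)%N -> C A ->
     dens_at R N A <= upper_dens R A) ->
  upper_dens R (\bigcup_(A in C) A) = sup [set upper_dens R A | A in C].
Proof.
move=> chC domC; have [->|C0] := eqVneq C set0.
  rewrite image_set0 sup0 bigcup_set0.
  by have [h0 d0] := has_dens0 R; rewrite (has_densE h0).1.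
move/set0P : C0 => C0; apply/eqP; rewrite eq_le; apply/andP; split.
  apply: upper_dens_le_ub => N N0.
  have [A CA capA] := chain_captures_initial_segment N C0 chC.
  apply: le_trans (dens_at_restrict_le R capA) _.
  apply: le_trans (domC _ _ N0 CA) _.
  by apply: ub_le_sup; [exact: upper_dens_sup_ub|exists A].
have [A CA] := C0; apply: ge_sup; first by exists (upper_dens R A); exists A.
by move=> _ [B CB <-]; apply: upper_dens_le; exact: bigcup_sup.
Qed.

Lemma sup_densE (R : realType) (C : set (set posnat)) : C `<=` has_dens R ->
  [set upper_dens R A | A in C] = [set dens R A | A in C] /\
  [set lower_dens R A | A in C] = [set dens R A | A in C].
Proof.
by move=> hC; split; apply: eq_imagel => A /hC /has_densE[].
Qed.

Lemma has_dens_chain (R : realType) (C : set (set posnat)) : is_chain C ->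
  (forall (N : nat) (A : set posnat), (0 < N)%N -> C A ->
     dens_at R N A <= upper_dens R A) ->
  C `<=` has_dens R ->
  has_dens R (\bigcup_(A in C) A) /\
  dens R (\bigcup_(A in C) A) = sup [set dens R A | A in C].
Proof.
move=> chC domC hC; have [eu el] := sup_densE hC; apply: has_dens_sandwich.
- by rewrite -el lower_dens_bigcup_ge.
- by rewrite upper_dens_chain// eu.
Qed.

(** The partial unions form a chain, and the domination of the proportions of the
    [A k] by their densities is inherited by finite disjoint unions, because both
    sides are additive. *)
Lemma has_dens_dominated_bigcup (R : realType) (A : nat -> set posnat) :
  (forall k, has_dens R (A k)) -> trivIset setT A ->
  (forall k N : nat, (0 < N)%N -> dens_at R N (A k) <= dens R (A k)) ->
  has_dens R (\bigcup_(k in [set: nat]) A k) /\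
  ((dens R (\bigcup_(k in [set: nat]) A k))%:E =
   \sum_(0 <= k <oo) (dens R (A k))%:E)%E.
Proof.
move=> hA tA domA.
have hU n := has_dens_partial_union n hA tA.
pose C := range (partial_union A).
have UC : \bigcup_(B in C) B = \bigcup_(k in [set: nat]) A k.
  apply/seteqP; split => [x [_ [n _ <-]]|x [k _ Akx]].
    exact: partial_union_sub.
  by exists (partial_union A k.+1); [exists k.+1|exists ord_max].
have chC : is_chain C.
  have incr m n : (m <= n)%N -> partial_union A m `<=` partial_union A n.
    by move=> mn x [k _ Akx]; exists (widen_ord mn k).
  move=> _ _ [m _ <-] [n _ <-].
  by case/orP : (leq_total m n) => /incr; [left|right].
have hC : C `<=` has_dens R by move=> _ [n _ <-]; exact: (hU n).1.
have domC N B : (0 < N)%N -> C B -> dens_at R N B <= upper_dens R B.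
  move=> N0 [n _ <-]; rewrite (has_densE (hU n).1).1 (hU n).2 big_mkord.
  rewrite dens_at_bigcup; last exact: trivIset_ord.
  by apply: ler_sum => k _; exact: domA.
have [hUA dUA] := has_dens_chain chC domC hC; rewrite UC in hUA dUA; split => //.
(* The series bounds the supremum of its partial sums, and the lower density of
   the union, now equal to the density, bounds the series. *)
apply/eqP; rewrite eq_le -[X in _ && (_ <= X%:E)%E](has_densE hUA).2.
rewrite dens_series_le_lower// andbT dUA.
have d0 k : (0 <= (dens R (A k))%:E)%E by rewrite lee_fin dens_ge0.
have Sfin : (\sum_(0 <= k <oo) (dens R (A k))%:E)%E \is a fin_num.
  rewrite ge0_fin_numE ?nneseries_ge0//.
  exact: le_lt_trans (dens_series_le_lower hA tA) (ltry _).
rewrite -(fineK Sfin) lee_fin; apply: ge_sup.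
  by exists (dens R (partial_union A 0)), (partial_union A 0) => //; exists 0%N.
move=> _ [_ [n _ <-] <-]; rewrite (hU n).2 -lee_fin (fineK Sfin) -sumEFin.
by apply: nneseries_lim_ge => k _ _.
Qed.

(** * Unions of full density *)

Lemma has_dens_lower1 (R : realType) (A : set posnat) :
  1 <= lower_dens R A -> has_dens R A /\ dens R A = 1.
Proof. by move=> A1; apply: has_dens_sandwich A1 (upper_dens_le1 R A). Qed.

Lemma has_dens_bigcup_sup1 (R : realType) (C : set (set posnat)) :
  C `<=` has_dens R -> sup [set dens R A | A in C] = 1 ->
  has_dens R (\bigcup_(A in C) A) /\ dens R (\bigcup_(A in C) A) = 1.
Proof.
move=> hC C1; apply: has_dens_lower1.
by rewrite -C1 -(sup_densE hC).2 lower_dens_bigcup_ge.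
Qed.

Lemma has_dens_bigcup_series1 (R : realType) (A : nat -> set posnat) :
  (forall k, has_dens R (A k)) -> trivIset setT A ->
  (\sum_(0 <= k <oo) (dens R (A k))%:E = 1)%E ->
  has_dens R (\bigcup_(k in [set: nat]) A k) /\
  dens R (\bigcup_(k in [set: nat]) A k) = 1.
Proof.
move=> hA tA A1; apply: has_dens_lower1.
by rewrite -lee_fin -A1 dens_series_le_lower.
Qed.

Theorem lemma2 (R : realType) :
  (* 1 *)
  ((has_dens R set0 /\ has_dens R setT) /\
   (dens R set0 = 0 /\ dens R setT = 1)) /\
  (* 2 *)
  (forall A : set posnat, has_dens R A ->
     has_dens R (~` A) /\ dens R (~` A) = 1 - dens R A) /\
  (* 3 *)
  (forall A B : set posnat, has_dens R A -> has_dens R B ->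
     (has_dens R (A `|` B) <-> has_dens R (A `&` B)) /\
     (has_dens R (A `|` B) \/ has_dens R (A `&` B) ->
      dens R (A `|` B) = dens R A + dens R B - dens R (A `&` B))) /\
  (* 4 *)
  ((forall A B : set posnat,
      upper_dens R (A `|` B) <= upper_dens R A + upper_dens R B) /\
   (forall A B : set posnat,
      has_dens R A -> has_dens R B -> has_dens R (A `|` B) ->
      dens R (A `|` B) <= dens R A + dens R B)) /\
  (* 5 *)
  (forall A B : set posnat, A `<=` B ->
     [/\ upper_dens R A <= upper_dens R B,
         upper_dens R (B `\` A) >= upper_dens R B - upper_dens R A,
         lower_dens R A <= lower_dens R B &
         lower_dens R (B `\` A) <= lower_dens R B - lower_dens R A] /\
     (has_dens R A -> has_dens R B ->
      [/\ dens R A <= dens R B,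
          has_dens R (B `\` A),
          dens R (B `\` A) = dens R B - dens R A &
          (dens R A = dens R B <-> null_dens R (B `\` A))])) /\
  (* 6 *)
  ((forall A B : set posnat, null_dens R A -> B `<=` A -> null_dens R B) /\
   (forall A C : set posnat, null_dens R A ->
      [/\ (null_dens R (A `&` C) /\ null_dens R (A `\` C)),
          (upper_dens R (A `|` C) = upper_dens R (C `\` A) /\
           upper_dens R (C `\` A) = upper_dens R C) &
          (has_dens R C -> has_dens R (A `|` C) /\ has_dens R (C `\` A))])) /\
  (* 7 *)
  (forall (K : nat) (A : 'I_K -> set posnat), (0 < K)%N ->
     (forall k, has_dens R (A k)) -> trivIset [set: 'I_K] A ->
     has_dens R (\bigcup_(k in [set: 'I_K]) A k) /\
     dens R (\bigcup_(k in [set: 'I_K]) A k) = \sum_(k < K) dens R (A k)) /\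
  (* 8 *)
  ((forall C : set (set posnat),
      lower_dens R (\bigcup_(A in C) A) >= sup [set lower_dens R A | A in C]) /\
   (forall A : nat -> set posnat,
      (forall k, has_dens R (A k)) -> trivIset [set: nat] A ->
      ((lower_dens R (\bigcup_(k in [set: nat]) A k))%:E >=
       \sum_(0 <= k <oo) (dens R (A k))%:E)%E)) /\
  (* 9 *)
  ((forall C : set (set posnat), is_chain C ->
      (forall (N : nat) (A : set posnat), (0 < N)%N -> C A ->
         dens_at R N A <= upper_dens R A) ->
      upper_dens R (\bigcup_(A in C) A) = sup [set upper_dens R A | A in C] /\
      (C `<=` has_dens R ->
       has_dens R (\bigcup_(A in C) A) /\
       dens R (\bigcup_(A in C) A) = sup [set dens R A | A in C])) /\
   (forall A : nat -> set posnat,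
      (forall k, has_dens R (A k)) -> trivIset [set: nat] A ->
      (forall k N : nat, (0 < N)%N -> dens_at R N (A k) <= dens R (A k)) ->
      has_dens R (\bigcup_(k in [set: nat]) A k) /\
      ((dens R (\bigcup_(k in [set: nat]) A k))%:E =
       \sum_(0 <= k <oo) (dens R (A k))%:E)%E)) /\
  (* 10 *)
  ((forall C : set (set posnat), C `<=` has_dens R ->
      sup [set dens R A | A in C] = 1 ->
      has_dens R (\bigcup_(A in C) A) /\ dens R (\bigcup_(A in C) A) = 1) /\
   (forall A : nat -> set posnat,
      (forall k, has_dens R (A k)) -> trivIset [set: nat] A ->
      (\sum_(0 <= k <oo) (dens R (A k))%:E = 1)%E ->
      has_dens R (\bigcup_(k in [set: nat]) A k) /\
      dens R (\bigcup_(k in [set: nat]) A k) = 1)).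

Proof.
split; first by have [[? ?] [? ?]] := (has_dens0 R, has_densT R).
split; first exact: has_densC.
split; first exact: has_densU.
split.
  split=> [A B|A B hA hB hU]; first exact: upper_densU_le.
  by rewrite -(has_densE hA).1 -(has_densE hB).1 -(has_densE hU).1 upper_densU_le.
split.
  move=> A B AB; split.
    by split; [exact: upper_dens_le|exact: upper_densD_ge|
      exact: lower_dens_le|exact: lower_densD_le].
  move=> hA hB; have [hD dD] := has_densD AB hA hB.
  split=> //; first exact: dens_le.
  rewrite /null_dens /= dD; split=> [->|[_ /eqP]]; first by rewrite subrr.
  by rewrite subr_eq0 => /eqP.
split.
  split=> [A B nA BA|A C nA]; first exact: null_dens_sub BA.
  split.
  - by split; apply: null_dens_sub nA _; [exact: subIsetl|exact: subDsetl].
  - exact: upper_dens_null_eq.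
  - exact: has_dens_null_modification.
split; first by move=> K A _; exact: has_dens_bigcup_fin.
split; first by split; [exact: lower_dens_bigcup_ge|exact: dens_series_le_lower].
split; first split.
- move=> C chC domC; split; [exact: upper_dens_chain|exact: has_dens_chain].
- exact: has_dens_dominated_bigcup.
by split; [exact: has_dens_bigcup_sup1|exact: has_dens_bigcup_series1].
Qed.
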